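(* Let $\mathcal{G}$ be a connected undirected graph on $n\ge 2$ vertices with Laplacian $L$ and incidence matrix $\mathcal{B}$, let $\lambda_2=\lambda_2(L)$ be its algebraic connectivity, and let $k_p,k_u>0$. Consider the system $$\dot{\boldsymbol{x}}(t)=\begin{bmatrix}\mathbf{0}_n & I_n\\ -k_pL & -k_uL\end{bmatrix}\boldsymbol{x}(t)+\begin{bmatrix}\mathbf{0}_{n\times1}\\ k_p\mathbf{\Delta}\end{bmatrix}+\begin{bmatrix}\mathbf{0}_n\\ I_n\end{bmatrix}\mathbf{w}(t),\qquad \mathbf{y}(t)=\mathcal{B}^{\mathsf T}\mathbf{P}(t),$$ where $\boldsymbol{x}=(\mathbf{P},\dot{\mathbf{P}})$, $\mathbf{P}=[p_1,\dots,p_n]^{\mathsf T}$. The system $\mathcal{H}_\infty$ norm from the external disturbances $\mathbf{w}(t)$ to $\mathbf{y}=\mathcal{B}^{\mathsf T}\mathbf{P}$ is $$\|G\|_\infty=\begin{cases}\dfrac{2}{k_u\lambda_2\sqrt{4k_p-k_u^2\lambda_2}}, & \text{if } \dfrac{\lambda_2k_u^2}{2k_p}\le 1,\\[2ex] \dfrac{1}{k_p\lambda_2^{1/2}}, & \text{otherwise.}\end{cases}$$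
   Context: The Laplacian is $L=D-A$, where $A$ is the $0/1$ adjacency matrix of $\mathcal{G}$ and $D$ the diagonal matrix of vertex degrees; its eigenvalues are $0=\lambda_1(L)\le\lambda_2(L)\le\dots\le\lambda_n(L)$, and $\lambda_2(L)$ is the algebraic connectivity. Fix an arbitrary orientation of the $m$ edges $e_1,\dots,e_m$; the incidence matrix $\mathcal{B}\in\mathbb{R}^{n\times m}$ has $[\mathcal{B}]_{kl}=1$ if vertex $k$ is the head of edge $l$, $-1$ if it is the tail of edge $l$, and $0$ otherwise, so $L=\mathcal{B}\mathcal{B}^{\mathsf T}$. The system is the vector form of the vehicle formation law $\ddot p_i=\sum_{j\in\mathcal{N}_i}\big[k_p(p_j-p_i+\Delta_{ij})+k_u(u_j-u_i)\big]+w_i$, where $\mathcal{N}_i$ is the set of neighbors of vertex $i$, $p_i$ and $u_i=\dot p_i$ are the position and velocity of vehicle $i$, $\Delta_{ij}$ are constant desired inter-vehicle distances satisfying $\Delta_{ij}=\Delta_{ik}+\Delta_{kj}$, and $\mathbf{\Delta}=[\Delta_1,\dots,\Delta_n]^{\mathsf T}$ with $\Delta_i=\sum_{j\in\mathcal{N}_i}\Delta_{ij}$. The constant term $k_p\mathbf{\Delta}$ plays no role in the transfer function from $\mathbf{w}$ to $\mathbf{y}$. The transfer function from $\mathbf{w}$ to $\mathbf{y}$ is $$G(s)=\begin{bmatrix}\mathcal{B}^{\mathsf T} & 0\end{bmatrix}\left(sI_{2n}-\begin{bmatrix}\mathbf{0}_n & I_n\\ -k_pL & -k_uL\end{bmatrix}\right)^{-1}\begin{bmatrix}\mathbf{0}_n\\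 I_n\end{bmatrix},$$ understood as a matrix of rational functions after cancellation of removable singularities (in particular at $s=0$). The $\mathcal{H}_\infty$ norm is $\|G\|_\infty=\sup_{\omega\in\mathbb{R}}\sigma_{\max}(G(j\omega))$, with $\sigma_{\max}$ the largest singular value and $j=\sqrt{-1}$. *)

(* Defs.v *)
From HB Require Import structures.
From mathcomp Require Import all_boot all_order all_algebra.
From mathcomp Require Import sesquilinear spectral.
From mathcomp Require Import complex.
From mathcomp Require Import classical_sets reals constructive_ereal ereal.

Set Implicit Arguments.
Unset Strict Implicit.
Unset Printing Implicit Defensive.

Import Order.TTheory GRing.Theory Num.Theory.
Local Open Scope ring_scope.
Local Open Scope complex_scope.
Local Open Scope sesquilinear_scope.

(* A simple undirected graph on the vertices 0, .., n-1 is a symmetric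
   irreflexive relation e on 'I_n. *)

Definition graph_connected n (e : rel 'I_n) : Prop := forall i j, connect e i j.

Definition adjacency (R : realType) n (e : rel 'I_n) : 'M[R]_n :=
  \matrix_(i, j) (e i j)%:R.

Definition graph_degree n (e : rel 'I_n) (i : 'I_n) : nat := #|[set j | e i j]|.

Definition laplacian (R : realType) n (e : rel 'I_n) : 'M[R]_n :=
  diag_mx (\row_i (graph_degree e i)%:R) - adjacency R e.

(* Edge l joins tl l to hd l. Injectivity on unordered pairs makes every
   undirected edge appear exactly once, in one of its two directions. *)
Definition oriented_edges n m (e : rel 'I_n) (hd tl : 'I_m -> 'I_n) : Prop :=
  injective (fun l => [set hd l; tl l]) /\
  forall i j, e i j <-> exists l, [set hd l; tl l] = [set i; j].

Definition incidence (R : realType) n m (hd tl : 'I_m -> 'I_n) :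
    'M[R]_(n, m) :=
  \matrix_(k, l) if k == hd l then 1 else if k == tl l then - 1 else 0.

(* Eigenvalues of a Hermitian matrix in nondecreasing order, repeated according
   to multiplicity; see char_poly_herm_eigvals. *)
Definition herm_eigvals (R : realType) n (A : 'M[R[i]]_n) : seq R :=
  sort <=%R [seq complex.Re (spectral_diag A 0 i) | i <- enum 'I_n].

Lemma char_poly_herm_eigvals (R : realType) n (A : 'M[R[i]]_n) :
  A \is hermsymmx ->
  char_poly A = \prod_(x <- herm_eigvals A) ('X - (x%:C)%:P).
Proof.
move=> hA; have /hermitian_normalmx/orthomx_spectralP eqA := hA.
set P := spectralmx A in eqA; set d := spectral_diag A in eqA.
have uP : P \in unitmx by exact: spectral_unit.
have -> : char_poly A = char_poly (diag_mx d).
  have hP : map_mx polyC (invmx P) *m map_mx polyC P = 1%:M.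
    by rewrite -map_mxM mulVmx // map_mx1.
  have -> : char_poly A = \det (map_mx polyC (invmx P) *m
      char_poly_mx (diag_mx d) *m map_mx polyC P).
    rewrite /char_poly {1}eqA; congr (\det _).
    rewrite /char_poly_mx mulmxBr mulmxBl !map_mxM; congr (_ - _).
    by rewrite scalar_mxC -mulmxA hP mulmx1.
  by rewrite !det_mulmx mulrAC -det_mulmx hP det1 mul1r.
rewrite char_poly_trig ?diag_mx_is_trig // /herm_eigvals.
rewrite (perm_big _ (permEl (perm_sort _ _))) /= big_map big_enum /=.
apply: eq_bigr => i _; rewrite mxE eqxx mulr1n; congr ('X - _%:P).
have /mxOverP/(_ 0 i) := hermitian_spectral_diag_real hA.
by rewrite -/d => /complex_realP [x ->].
Qed.

(* Index 1 is the second smallest eigenvalue: sequences are numbered from 0. *)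
Definition algebraic_connectivity (R : realType) n (e : rel 'I_n) : R :=
  (herm_eigvals (map_mx (real_complex R) (laplacian R e)))`_1.

Definition sigma_max (R : realType) q p (M : 'M[R[i]]_(q, p)) : R :=
  Num.sqrt (last 0 (herm_eigvals (M ^t* *m M))).

(* Rational functions: elements of the fraction field of F[X]. Pole and value
   are read off the fraction in lowest terms, so that removable singularities
   are cancelled; see ratfunP. *)
Notation ratfun F := {fraction {poly F}}.

Definition rnum (F : fieldType) (f : ratfun F) : {poly F} :=
  let r := repr f in \n_r %/ gcdp \n_r \d_r.

Definition rden (F : fieldType) (f : ratfun F) : {poly F} :=
  let r := repr f in \d_r %/ gcdp \n_r \d_r.

Definition rpole (F : fieldType) (f : ratfun F) (z : F) : bool :=
  root (rden f) z.

Definition reval (F : fieldType) (f : ratfun F) (z : F) : F :=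
  (rnum f).[z] / (rden f).[z].

Lemma ratfunP (F : fieldType) (p q : {poly F}) (z : F) : q.[z] != 0 ->
  let f : ratfun F := tofrac p / tofrac q in
  ~~ rpole f z /\ reval f z = p.[z] / q.[z].
Proof.
move=> qz /=; set f : ratfun F := _ / _.
have q0 : q != 0 by apply: contraNneq qz => ->; rewrite horner0.
set u := \n_(repr f); set v := \d_(repr f).
have v0 : v != 0 by exact: denom_ratioP.
have fE : f = tofrac u / tofrac v.
  have vu : tofrac v != 0 :> ratfun F by rewrite tofrac_eq0.
  rewrite /u /v -[f in LHS]reprK.
  change (\pi_(ratfun F)%qT (repr f) =
    FracField.mul (tofrac u) (FracField.inv (tofrac v))).
  rewrite !piE; apply/eqmodP => /=.
  rewrite /FracField.equivf /FracField.mulf /FracField.invf.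
  rewrite !numden_Ratio ?oner_eq0 ?mulr1 ?mul1r //.
  by rewrite mulrC.
have cross : u * q = p * v.
  apply/eqP; rewrite -tofrac_eq !tofracM; apply/eqP.
  have : tofrac p / tofrac q = tofrac u / tofrac v by exact: fE.
  move/eqP; rewrite eqr_div ?tofrac_eq0 // => /eqP ->.
  by [].
set g := gcdp u v.
have g0 : g != 0 by rewrite gcdp_eq0 negb_and v0 orbT.
have uE : u = rnum f * g by rewrite /rnum -/u -/v -/g divpK // dvdp_gcdl.
have vE : v = rden f * g by rewrite /rden -/u -/v -/g divpK // dvdp_gcdr.
have cross' : rnum f * q = p * rden f.
  by apply: (mulIf g0); rewrite mulrAC -uE cross {1}vE mulrA.
have cop : coprimep (rden f) (rnum f).
  by rewrite coprimep_sym /rnum /rden coprimep_div_gcd // v0 orbT.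
have dvd : rden f %| q.
  by rewrite -(Gauss_dvdpr _ cop) cross' dvdp_mull.
have dz : (rden f).[z] != 0.
  by apply: contraNneq qz => h; rewrite -rootE (root_dvdp dvd) // rootE h.
split; first by [].
apply/eqP; rewrite /reval eqr_div //; apply/eqP.
by have := congr1 (fun r => r.[z]) cross'; rewrite !hornerM.
Qed.

(* The affine system x' = A x + f + B w, y = C x with N states, p inputs and
   q outputs. *)
Record affine_system (R : realType) (N p q : nat) := AffineSystem {
  sysA : 'M[R]_N;
  sysf : 'cV[R]_N;
  sysB : 'M[R]_(N, p);
  sysC : 'M[R]_(q, N) }.

Definition ratc (R : realType) (a : R) : ratfun R[i] := tofrac (a%:C)%:P.

(* C (s I - A)^-1 B; the constant term f does not contribute. *)
Definition transfer_function (R : realType) N p q (S : affine_system R N p q) :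
    'M[ratfun R[i]]_(q, p) :=
  map_mx (@ratc R) (sysC S)
  *m invmx ((tofrac 'X)%:M - map_mx (@ratc R) (sysA S))
  *m map_mx (@ratc R) (sysB S).

(* Largest singular value of G(z), set to +oo at a pole of G. *)
Definition gain (R : realType) q p (G : 'M[ratfun R[i]]_(q, p)) (z : R[i]) :
    \bar R :=
  if [exists i, exists j, rpole (G i j) z] then +oo%E
  else (sigma_max (map_mx (fun f => reval f z) G))%:E.

Definition hinf_norm (R : realType) q p (G : 'M[ratfun R[i]]_(q, p)) : \bar R :=
  ereal_sup (range (fun w : R => gain G (0 +i* w))).

Definition desired_offset (R : realType) n (e : rel 'I_n)
    (Delta : 'I_n -> 'I_n -> R) : 'cV[R]_n :=
  \col_i \sum_(j | e i j) Delta i j.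

(* State (P, P'), disturbance w, output B^T P. *)
Definition formation_system (R : realType) n m (e : rel 'I_n)
    (hd tl : 'I_m -> 'I_n) (kp ku : R) (Delta : 'I_n -> 'I_n -> R) :
    affine_system R (n + n) n m :=
  AffineSystem
    (block_mx 0 1%:M (- (kp *: laplacian R e)) (- (ku *: laplacian R e)))
    (col_mx 0 (kp *: desired_offset e Delta))
    (col_mx 0 1%:M)
    (row_mx (incidence R hd tl)^T 0).

(* Main.v *)
Require Import Defs.
From HB Require Import structures.
From mathcomp Require Import all_boot all_order all_algebra.
From mathcomp Require Import sesquilinear spectral.
From mathcomp Require Import complex.
From mathcomp Require Import classical_sets reals constructive_ereal ereal.
From mathcomp Require Import ring lra.

(** The Laplacian is a Gram matrix, L = B B^T ([laplacian_incidence]). Let P be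
    a unitary matrix with P L P^* = diag(d), and W = P B, so that
    W W^* = diag(d) ([gram_spectral]). In the eigenbasis the dynamics decouple
    into scalar second order systems, and
      G(s) = W^* diag(1 / (s^2 + ku d_i s + kp d_i)) P
    as a matrix of rational functions ([transfer_function_modal]).

    A mode with d_i = 0 meets a zero row of W, so its double pole at the origin
    does not occur in G. For d_i > 0 the denominator has no root on the
    imaginary axis. Hence G has no pole there, and G(iw)^* G(iw) is unitarily
    similar to the diagonal matrix of the
      d_i / ((kp d_i - w^2)^2 + (ku d_i w)^2),
    whose largest entry is the square of the gain ([gain_modal]).

    Since the graph is connected, 0 is a simple eigenvalue and every other
    eigenvalue is at least lambda2 > 0 ([laplacian_spectrum]). It remains to
    maximize x / ((kp x - w^2)^2 + (ku x w)^2) over w real and x >= lambda2.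
    The supremum over w decreases with x, so the slowest mode x = lambda2
    governs the norm. For that mode the denominator is a quadratic polynomial
    in w^2, with vertex kp lambda2 - ku^2 lambda2^2 / 2. When the vertex is
    nonnegative it is a resonance frequency squared and gives the first case;
    otherwise the maximum is the static gain at w = 0, the second case
    ([mode_gain_le], [mode_gain_attained]). *)

Set Implicit Arguments.
Unset Strict Implicit.
Unset Printing Implicit Defensive.

Import Order.TTheory GRing.Theory Num.Theory.
Local Open Scope ring_scope.
Local Open Scope complex_scope.
Local Open Scope sesquilinear_scope.

(** * The Laplacian as a Gram matrix *)

Lemma incidence_col_sum (R : realType) n m (hd tl : 'I_m -> 'I_n) l :
  hd l != tl l -> \sum_k incidence R hd tl k l = 0.
Proof.
move=> hdtl; rewrite (bigD1 (hd l)) //= (bigD1 (tl l)) 1?eq_sym //=.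
rewrite !mxE eqxx eq_sym (negPf hdtl) eqxx big1 => [|k /andP [kh kt]].
  by rewrite addr0 subrr.
by rewrite mxE (negPf kh) (negPf kt).
Qed.

Lemma oriented_edges_neq n m (e : rel 'I_n) (hd tl : 'I_m -> 'I_n) l :
  irreflexive e -> oriented_edges e hd tl -> hd l != tl l.
Proof.
move=> e_irr [_ edges]; apply/negP => /eqP hdtl.
have: e (hd l) (tl l) by apply/edges; exists l.
by rewrite hdtl e_irr.
Qed.

(** An edge meeting two distinct vertices i and j has one of them as head and
    the other as tail, whence the product -1. *)
Lemma incidence_mul_neq (R : realType) n m (hd tl : 'I_m -> 'I_n) i j l :
  i != j -> hd l != tl l ->
  incidence R hd tl i l * incidence R hd tl j l =
  if [set hd l; tl l] == [set i; j] then -1 else 0.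
Proof.
move=> ij hdtl; rewrite !mxE.
have -> : ([set hd l; tl l] == [set i; j]) =
    (i == hd l) && (j == tl l) || (i == tl l) && (j == hd l).
  apply/eqP/orP => [E|[] /andP [/eqP-> /eqP->] //]; last first.
    by rewrite finset.setUC.
  have : i \in [set hd l; tl l] by rewrite E !inE eqxx.
  have : j \in [set hd l; tl l] by rewrite E !inE eqxx orbT.
  rewrite !inE => /orP [] /eqP Ej /orP [] /eqP Ei.
  - by move: ij; rewrite Ei Ej eqxx.
  - by right; rewrite Ei Ej !eqxx.
  - by left; rewrite Ei Ej !eqxx.
  - by move: ij; rewrite Ei Ej eqxx.
case: (i =P hd l) => [Ei|_]; case: (j =P hd l) => [Ej|_] /=.
- by move: ij; rewrite Ei Ej eqxx.
- by rewrite mul1r Ei (negPf hdtl) /= orbF.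
- by rewrite mulr1 andbT.
- by rewrite andbF; case: (i =P tl l) => [Ei|_]; case: (j =P tl l) => [Ej|_];
    rewrite ?mul0r ?mulr0 //; move: ij; rewrite Ei Ej eqxx.
Qed.

(** A diagonal entry of a matrix with zero row sums is minus the sum of the
    other entries of its row. This is what makes it possible to identify the
    Laplacian without counting the edges at a vertex. *)
Lemma eq_mx_row_sum0 (K : nzRingType) n (A B : 'M[K]_n) :
  (forall i, \sum_j A i j = 0) -> (forall i, \sum_j B i j = 0) ->
  (forall i j, i != j -> A i j = B i j) -> A = B.
Proof.
move=> A0 B0 AB; apply/matrixP => i j; have [<-{j}|/AB //] := eqVneq i j.
have: \sum_j A i j = \sum_j B i j by rewrite A0 B0.
rewrite !(bigD1 (P := xpredT) i) //=.
rewrite (eq_bigr (B i)) => [|k ki]; first exact: addIr.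
by rewrite AB // eq_sym.
Qed.

(** Both sides have zero row sums: on the left degrees cancel adjacencies, on
    the right each column of the incidence matrix sums to zero. Off the
    diagonal, the only edge contributing to the entry (i, j) is the one joining
    i to j, and it is unique. *)
Lemma laplacian_incidence (R : realType) n m (e : rel 'I_n)
    (hd tl : 'I_m -> 'I_n) :
  irreflexive e -> oriented_edges e hd tl ->
  laplacian R e = incidence R hd tl *m (incidence R hd tl)^T.
Proof.
move=> e_irr ed; have hdtl l := oriented_edges_neq l e_irr ed.
apply: eq_mx_row_sum0 => [i|i|i j ij].
- under eq_bigr do rewrite !mxE.
  rewrite sumrB -natr_sum -big_mkcond sum1dep_card /graph_degree.
  rewrite (bigD1 i) //= eqxx mulr1n big1 ?addr0 ?subrr // => j.
  by rewrite eq_sym => /negPf->.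
- under eq_bigr do rewrite mxE.
  rewrite exchange_big big1 //= => l _; under eq_bigr do rewrite [_^T _ _]mxE.
  by rewrite -mulr_sumr incidence_col_sum // mulr0.
- rewrite [RHS]mxE (eq_bigr (fun l =>
    if [set hd l; tl l] == [set i; j] then -1 else 0)); last first.
    by move=> l _; rewrite [_^T _ _]mxE incidence_mul_neq.
  rewrite !mxE (negPf ij) mulr0n sub0r.
  case: ed => inj edges; have [eij|/negP neij] := boolP (e i j).
    have [l El] := (edges i j).1 eij.
    rewrite (bigD1 l) //= El eqxx big1 ?addr0 // => l' ll'.
    case: eqP => // E; case/eqP: ll'; apply: inj; by rewrite E.
  rewrite big1 ?oppr0 // => l _; case: eqP => // E.
  by case: neij; apply/edges; exists l.
Qed.

(** * Eigenvalues of Hermitian matrices *)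

Lemma char_poly_conj (K : comNzRingType) n (Q D P : 'M[K]_n) :
  Q *m P = 1%:M -> char_poly (Q *m D *m P) = char_poly D.
Proof.
move=> QP; have QPX : map_mx polyC Q *m map_mx polyC P = 1%:M.
  by rewrite -map_mxM QP map_mx1.
rewrite /char_poly; have -> : char_poly_mx (Q *m D *m P) =
    map_mx polyC Q *m char_poly_mx D *m map_mx polyC P.
  rewrite /char_poly_mx mulmxBr mulmxBl !map_mxM; congr (_ - _).
  by rewrite scalar_mxC -mulmxA QPX mulmx1.
by rewrite !det_mulmx mulrAC -det_mulmx QPX det1 mul1r.
Qed.

(** The eigenvalue list is defined from a chosen diagonalization; the
    characteristic polynomial shows that any unitary diagonalization yields
    the same multiset, hence the same sorted list. *)
Lemma herm_eigvals_unitary_diag (R : realType) n (P : 'M[R[i]]_n)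
    (a : 'I_n -> R) : P \is unitarymx ->
  herm_eigvals (P^t* *m diag_mx (\row_i (a i)%:C) *m P) =
  sort <=%R [seq a i | i <- enum 'I_n].
Proof.
move=> uP; set D := diag_mx _; set A := _ *m P.
have hA : A \is hermsymmx.
  apply/is_hermitianmxP; rewrite expr0 scale1r /A !trmx_mul !map_mxM trmxCK.
  rewrite mulmxA; congr (_ *m _ *m _).
  by apply/matrixP => i j; rewrite !mxE; have [<-|_] := eqVneq i j;
    rewrite ?mulr1n ?mulr0n ?rmorph0 //; apply/eqP;
    rewrite eq_complex /= oppr0 !eqxx.
have : char_poly A = \prod_(x <- [seq a i | i <- enum 'I_n]) ('X - (x%:C)%:P).
  have -> : char_poly A = char_poly D.
    apply: char_poly_conj; rewrite -invmx_unitary // mulVmx //.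
    exact: unitarymx_unit.
  rewrite char_poly_trig ?diag_mx_is_trig // big_map big_enum /=.
  by apply: eq_bigr => i _; rewrite !mxE eqxx mulr1n.
rewrite char_poly_herm_eigvals //.
rewrite -!(big_map (real_complex R) xpredT (fun y => 'X - y%:P)).
move=> /prod_XsubC_eq /(perm_map_inj (@complexI R)) /perm_sort_leP <-.
by rewrite sort_le_id // /herm_eigvals sort_le_sorted.
Qed.

Lemma last_sort_max (R : realDomainType) (s : seq R) x :
  x \in s -> last 0 (sort <=%R s) \in s /\ x <= last 0 (sort <=%R s).
Proof.
rewrite -!(mem_sort <=%R s); have := sort_le_sorted s.
case/lastP: (sort _ s) => // t y; rewrite last_rcons.
rewrite (sorted_pairwise le_trans) pairwise_rcons => /andP [/allP ty _].
by rewrite !mem_rcons mem_head inE => /orP [/eqP ->|/ty].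
Qed.

Lemma conjC_real_complex (R : realType) (x : R) : Num.conj x%:C = x%:C.
Proof. exact: conjc_real. Qed.

Lemma real_gram_hermitian (R : realType) n m (B : 'M[R]_(n, m)) :
  map_mx (real_complex R) (B *m B^T) \is hermsymmx.
Proof.
apply/is_hermitianmxP; rewrite expr0 scale1r.
apply/matrixP => i j; rewrite !mxE conjC_real_complex; congr _%:C.
by apply: eq_bigr => l _; rewrite !mxE mulrC.
Qed.

Lemma real_complex_trC (R : realType) n m (B : 'M[R]_(n, m)) :
  (map_mx (real_complex R) B)^t* = map_mx (real_complex R) B^T.
Proof. by apply/matrixP => i j; rewrite !mxE conjC_real_complex. Qed.

(** The matrix W carries all that is used of B in the eigenbasis P: its rows
    are pairwise orthogonal, of squared norms the eigenvalues of B B^T. *)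
Lemma gram_spectral (R : realType) n m (B : 'M[R]_(n, m)) :
  exists (P : 'M[R[i]]_n) (d : 'I_n -> R),
    [/\ P \is unitarymx,
        map_mx (real_complex R) (B *m B^T) =
          P^t* *m diag_mx (\row_i (d i)%:C) *m P &
        let W := P *m map_mx (real_complex R) B in
        W *m W^t* = diag_mx (\row_i (d i)%:C)].
Proof.
set A := map_mx _ _; have hA := real_gram_hermitian B.
have /hermitian_normalmx/orthomx_spectralP eqA := hA.
have uP := spectral_unitarymx A; set P := spectralmx A in eqA uP.
pose d i := complex.Re (spectral_diag A 0 i); exists P, d.
have dE : spectral_diag A = \row_i (d i)%:C.
  apply/rowP => i; rewrite mxE RRe_real //.
  by have /mxOverP/(_ 0 i) := hermitian_spectral_diag_real hA.
have AE : A = P^t* *m diag_mx (\row_i (d i)%:C) *m P.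
  by rewrite -dE -invmx_unitary.
split=> //=; rewrite trmx_mul map_mxM real_complex_trC mulmxA -(mulmxA P).
rewrite -map_mxM -/A AE !mulmxA (unitarymxP uP) mul1mx -mulmxA (unitarymxP uP).
by rewrite mulmx1.
Qed.

(** The i-th diagonal entry is the squared norm of the i-th row of W. *)
Lemma gram_diag (R : realType) n m (W : 'M[R[i]]_(n, m)) (d : 'I_n -> R) i :
  W *m W^t* = diag_mx (\row_i (d i)%:C) ->
  0 <= d i /\ (d i = 0 -> forall l, W i l = 0).
Proof.
move=> /matrixP/(_ i i); rewrite !mxE eqxx mulr1n.
have term l : W i l * (W^t*) l i = `|W i l| ^+ 2 by rewrite !mxE -normCK.
under eq_bigr do rewrite term.
move=> dE; split=> [|d0 l].
  by rewrite -lecR -dE sumr_ge0 // => l _; rewrite exprn_ge0.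
have /psumr_eq0P h : \sum_l `|W i l| ^+ 2 = 0 by rewrite dE d0.
apply/eqP; rewrite -normr_eq0 -sqrf_eq0; exact/eqP/h.
Qed.

(** * The spectrum of a connected graph *)

Lemma incidence_mul (R : realType) n m p (hd tl : 'I_m -> 'I_n)
    (P : 'M[R[i]]_(p, n)) i l : hd l != tl l ->
  (P *m map_mx (real_complex R) (incidence R hd tl)) i l =
  P i (hd l) - P i (tl l).
Proof.
move=> hdtl; rewrite mxE (bigD1 (hd l)) //= (bigD1 (tl l)) 1?eq_sym //=.
rewrite !mxE eqxx eq_sym (negPf hdtl) eqxx rmorph1 rmorphN1 mulr1 mulrN1.
rewrite big1 ?addr0 // => k /andP [kh kt].
by rewrite !mxE (negPf kh) (negPf kt) rmorph0 mulr0.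
Qed.

(** A row vector killed by the incidence matrix takes equal values at the two
    ends of each edge, hence along every path. *)
Lemma connected_incidence_ker (R : realType) n m p (e : rel 'I_n)
    (hd tl : 'I_m -> 'I_n) (P : 'M[R[i]]_(p, n)) i :
  irreflexive e -> graph_connected e -> oriented_edges e hd tl ->
  (forall l, (P *m map_mx (real_complex R) (incidence R hd tl)) i l = 0) ->
  forall a b, P i a = P i b.
Proof.
move=> e_irr e_conn ed W0 a b.
have edge x y : e x y -> P i x = P i y.
  move=> /(ed.2 x y).1 [l El].
  have hdtl := oriented_edges_neq l e_irr ed.
  have := W0 l; rewrite incidence_mul // => /subr0_eq.
  have: x \in [set hd l; tl l] by rewrite El !inE eqxx.
  have: y \in [set hd l; tl l] by rewrite El !inE eqxx orbT.
  by move=> /set2P [->|->] /set2P [->|->].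
have /connectP [s] := e_conn a b.
elim: s a => [|x s IHs] a /= => [_ -> //|/andP [/edge -> /IHs]]; exact.
Qed.

(** The smallest entry is the only zero, so the next one in sorted order is
    the least positive entry. *)
Lemma second_smallest (R : realDomainType) n (d : 'I_n -> R) :
  (2 <= n)%N -> (forall i, 0 <= d i) -> (exists i, d i = 0) ->
  (forall i j, d i = 0 -> d j = 0 -> i = j) ->
  let l := (sort <=%R [seq d i | i <- enum 'I_n])`_1 in
  [/\ 0 < l, exists i, d i = l & forall i, d i = 0 \/ l <= d i].
Proof.
move=> n2 d0 [i0 di0] uniq0; set s := sort _ _ => /=.
have sE : perm_eq s [seq d i | i <- enum 'I_n] by rewrite perm_sort.
have mem_s i : d i \in s by rewrite (perm_mem sE) map_f ?mem_enum.
have s_mem x : x \in s -> exists i, d i = x.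
  by rewrite (perm_mem sE) => /mapP [i _ ->]; exists i.
have : sorted <=%R s by exact: sort_le_sorted.
have : (count_mem 0%R s <= 1)%N.
  rewrite (permP sE) count_map.
  have /eq_count -> : preim d (pred1 0) =1 pred1 i0.
    move=> i /=; apply/eqP/eqP => [di|->//]; exact: uniq0.
  by rewrite count_uniq_mem ?enum_uniq // leq_b1.
have : (1 < size s)%N by rewrite (perm_size sE) size_map size_enum_ord.
case: s mem_s s_mem {sE} => [|a [|b s]] mem_s s_mem //= _.
rewrite le_path_sortedE => cnt /and3P [ab bs _].
have [ia ea] := s_mem a (mem_head _ _).
have [ib eb] : exists i, d i = b by apply: s_mem; rewrite !inE eqxx orbT.
have ge_b x : x \in b :: s -> b <= x.
  by rewrite inE => /orP [/eqP ->|/(allP bs)].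
have a0 : a = 0.
  apply/eqP; rewrite eq_le -{2}ea d0 andbT.
  have := mem_s i0; rewrite di0 inE => /orP [/eqP <- //|/ge_b].
  exact: le_trans.
split; [|by exists ib|].
  rewrite lt_def -{2}eb d0 andbT; apply: contraTneq cnt => ->.
  by rewrite a0 !eqxx.
by move=> i; have := mem_s i; rewrite inE => /orP [/eqP ->|/ge_b]; [left|right].
Qed.

(** In the eigenbasis P, a zero eigenvalue forces a zero row of W, that is, a
    row of P which is constant because the graph is connected. So 0 is a simple
    eigenvalue, and the second smallest one is the least positive one. *)
Lemma laplacian_spectrum (R : realType) n m (e : rel 'I_n)
    (hd tl : 'I_m -> 'I_n) (P : 'M[R[i]]_n) (d : 'I_n -> R)
    (W := P *m map_mx (real_complex R) (incidence R hd tl)) :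
  (2 <= n)%N -> irreflexive e -> graph_connected e -> oriented_edges e hd tl ->
  P \is unitarymx -> W *m W^t* = diag_mx (\row_i (d i)%:C) ->
  let l := (sort <=%R [seq d i | i <- enum 'I_n])`_1 in
  [/\ 0 < l, exists i, d i = l & forall i, d i = 0 \/ l <= d i].
Proof.
move=> n2 e_irr e_conn ed uP WW.
have PtP : P^t* *m P = 1%:M.
  by rewrite -invmx_unitary // mulVmx // unitarymx_unit.
have ker i : d i = 0 -> forall a b, P i a = P i b.
  move=> di0; apply: (connected_incidence_ker e_irr e_conn ed).
  exact: (gram_diag i WW).2.
apply: second_smallest => // [i||i j di0 dj0].
- exact: (gram_diag i WW).1.
- (* 0 is an eigenvalue: the coordinates P 1 of the vector 1 form a nonzero
     vector killed by the diagonal matrix, as B^T 1 = 0. *)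
  pose u : 'cV[R[i]]_n := P *m const_mx 1.
  have Wu : W^t* *m u = 0.
    rewrite /u trmx_mul map_mxM -mulmxA (mulmxA _ P) PtP mul1mx.
    apply/matrixP => l k; rewrite real_complex_trC !mxE.
    have hdtl := oriented_edges_neq l e_irr ed.
    rewrite -[RHS](rmorph0 (real_complex R)) -(incidence_col_sum R hdtl).
    by rewrite rmorph_sum; apply: eq_bigr => j _; rewrite !mxE mulr1.
  have u0 : u != 0.
    apply/eqP => /(congr1 (mulmx (P^t*))); rewrite mulmx0 /u mulmxA PtP mul1mx.
    move=> /matrixP/(_ (Ordinal (ltnW n2)) 0)/eqP.
    by rewrite !mxE oner_eq0.
  have /matrix0Pn [i [k uik]] := u0; exists i.
  have /(congr1 (mulmxr u))/matrixP/(_ i k) := WW.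
  rewrite /= -mulmxA Wu mulmx0 mul_diag_mx !mxE => /esym/eqP.
  rewrite mulf_eq0 => /orP [/eqP/complexI //|uik0].
  by move: uik; rewrite mxE (eqP uik0) eqxx.
- (* 0 is simple: two distinct null rows of P would be constant, nonzero and
     orthogonal. *)
  apply/eqP; apply/negPn/negP => ij.
  have/unitarymxP PP := uP.
  have dot k l a : d k = 0 -> d l = 0 ->
      (k == l)%:R = (P k a * Num.conj (P l a)) *+ n.
    move=> dk dl; have /matrixP/(_ k l) := PP.
    rewrite !mxE => <-; rewrite (eq_bigr (fun=> P k a * Num.conj (P l a))).
      by rewrite sumr_const card_ord.
    by move=> b _; rewrite !mxE (ker _ dk b a) (ker _ dl b a).
  have nz k : d k = 0 -> P k i != 0.
    move=> dk; apply/eqP => Pk0; have := dot k k i dk dk.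
    by rewrite Pk0 mul0r mul0rn eqxx => /eqP; rewrite oner_eq0.
  have := dot i j i di0 dj0; rewrite (negPf ij) => /esym/eqP.
  rewrite mulrn_eq0 mulf_eq0 conjC_eq0 (negPf (nz _ di0)) (negPf (nz _ dj0)).
  by case: (n) n2.
Qed.

(** * Values of rational functions *)

(** A fraction need not be in lowest terms here, which makes this relation
    easily stable under sums and products; it still determines both the absence
    of a pole and the value. *)
Definition regular_value (F : fieldType) (z : F) (f : ratfun F) (v : F) :=
  exists p q : {poly F},
    [/\ q.[z] != 0, f = tofrac p / tofrac q & v = p.[z] / q.[z]].

Lemma regular_valueP (F : fieldType) (z : F) (f : ratfun F) v :
  regular_value z f v -> ~~ rpole f z /\ reval f z = v.
Proof. by move=> [p [q [qz -> ->]]]; exact: ratfunP. Qed.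

Lemma regular_poly (F : fieldType) (z : F) (p : {poly F}) :
  regular_value z (tofrac p) p.[z].
Proof. by exists p, 1; rewrite tofrac1 hornerC !divr1 oner_eq0. Qed.

Lemma regular_polyV (F : fieldType) (z : F) (q : {poly F}) : q.[z] != 0 ->
  regular_value z (tofrac q)^-1 q.[z]^-1.
Proof. by move=> qz; exists 1, q; rewrite tofrac1 hornerC !div1r. Qed.

Lemma tofrac_neq0 (F : fieldType) (z : F) (q : {poly F}) :
  q.[z] != 0 -> tofrac q != 0.
Proof. by rewrite tofrac_eq0; apply: contraNneq => ->; rewrite horner0. Qed.

Lemma regular_add (F : fieldType) (z : F) (f g : ratfun F) v w :
  regular_value z f v -> regular_value z g w -> regular_value z (f + g) (v + w).
Proof.
move=> [p [q [qz -> ->]]] [p' [q' [q'z -> ->]]].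
exists (p * q' + p' * q), (q * q').
split; first by rewrite hornerM mulf_neq0.
  rewrite tofracD !tofracM addf_div //.
    exact: tofrac_neq0 qz.
  exact: tofrac_neq0 q'z.
by rewrite !hornerE addf_div.
Qed.

Lemma regular_mul (F : fieldType) (z : F) (f g : ratfun F) v w :
  regular_value z f v -> regular_value z g w -> regular_value z (f * g) (v * w).
Proof.
move=> [p [q [qz -> ->]]] [p' [q' [q'z -> ->]]].
exists (p * p'), (q * q'); split; first by rewrite hornerM mulf_neq0.
  by rewrite !tofracM mulf_div.
by rewrite !hornerM mulf_div.
Qed.

Lemma regular_sum (F : fieldType) (z : F) I (r : seq I) (f : I -> ratfun F) v :
  (forall i, regular_value z (f i) (v i)) ->
  regular_value z (\sum_(i <- r) f i) (\sum_(i <- r) v i).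
Proof.
move=> fv; elim/big_ind2: _ => [|? ? ? ?|i _]; last exact: fv.
- rewrite -tofrac0 -[X in regular_value _ _ X](horner0 z).
  exact: regular_poly.
- exact: regular_add.
Qed.

(** * Modal form of the transfer function *)

(** The resolvent of the companion form of X'' = - a L X - b L X' + w reduces
    to the inverse Y of the quadratic pencil s^2 + s b L + a L. The inverse of
    the whole block matrix is explicit because L commutes with s + b L. *)
Lemma second_order_resolvent (K : fieldType) n (L Y : 'M[K]_n) (s a b : K) :
  (s ^+ 2 *: 1%:M + (s * b) *: L + a *: L) *m Y = 1%:M ->
  invmx (s%:M - block_mx 0 1%:M (- (a *: L)) (- (b *: L))) *m col_mx 0 1%:M =
  col_mx Y (s *: Y).
Proof.
move=> YI; set M := _ - _.
pose S := s *: 1%:M + b *: L.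
have ME : M = block_mx (s *: 1%:M) (- 1%:M) (a *: L) S.
  rewrite /M scalar_mx_block opp_block_mx add_block_mx !opprK oppr0.
  by rewrite addr0 !add0r /S !scalemx1.
have SY : s *: (S *m Y) + a *: (L *m Y) = 1%:M.
  by rewrite -[RHS]YI /S !mulmxDl -!scalemxAl scalerDr !scalerA expr2.
have LS : L *m S = S *m L.
  by rewrite /S mulmxDl mulmxDr -!scalemxAl -!scalemxAr mul1mx mulmx1.
(* N is the full resolvent; only its second block column is needed below. *)
pose N := block_mx (S *m Y) Y (- (a *: (L *m Y))) (s *: Y).
have MN : M *m N = 1%:M.
  rewrite ME mulmx_block -!scalemxAl !mul1mx !mulNmx !mul1mx opprK subrr.
  rewrite mulmxN -!scalemxAr !mulmxA LS subrr SY [_ + s *: _]addrC SY.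
  by rewrite scalar_mx_block.
have -> : invmx M = N.
  by rewrite -[N]mul1mx -(mulVmx (mulmx1_unit MN).1) -mulmxA MN mulmx1.
by rewrite mul_block_col !mulmx0 !add0r !mulmx1.
Qed.

Lemma diag_resolvent (K : fieldType) n (Q P : 'M[K]_n) (x : 'rV[K]_n)
    (s a b : K) (den := fun i => s ^+ 2 + s * b * x 0 i + a * x 0 i) :
  P *m Q = 1%:M -> (forall i, den i != 0) ->
  let L := Q *m diag_mx x *m P in
  (s ^+ 2 *: 1%:M + (s * b) *: L + a *: L) *m
    (Q *m diag_mx (\row_i (den i)^-1) *m P) = 1%:M.
Proof.
move=> PQ den0 /=; have QP := mulmx1C PQ.
have -> : s ^+ 2 *: 1%:M + (s * b) *: (Q *m diag_mx x *m P)
    + a *: (Q *m diag_mx x *m P) = Q *m diag_mx (\row_i den i) *m P.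
  have -> : diag_mx (\row_i den i) =
      s ^+ 2 *: 1%:M + (s * b) *: diag_mx x + a *: diag_mx x.
    apply/matrixP => i j; rewrite !mxE /den.
    by case: eqVneq => _; rewrite ?mulr1n ?mulr1 // !mulr0n !mulr0 !addr0.
  by rewrite !mulmxDr !mulmxDl -!scalemxAr -!scalemxAl mulmx1 QP.
rewrite !mulmxA -(mulmxA _ P Q) PQ mulmx1 -(mulmxA Q) mulmx_diag.
have -> : diag_mx (\row_j
    ((\row_i den i) 0 j * (\row_i (den i)^-1) 0 j)) = 1%:M.
  apply/matrixP => i j; rewrite !mxE; case: eqVneq => _ //.
  by rewrite divff // den0.
by rewrite mulmx1 QP.
Qed.

(** The characteristic polynomial s^2 + ku x s + kp x of the mode of
    eigenvalue x. *)
Definition modal_den (R : realType) (kp ku x : R) : {poly R[i]} :=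
  'X ^+ 2 + (ku * x)%:C *: 'X + (kp * x)%:C%:P.

Lemma modal_den_neq0 (R : realType) (kp ku x : R) : modal_den kp ku x != 0.
Proof.
apply/eqP => /(congr1 (fun p : {poly R[i]} => p`_2)).
rewrite !(coefD, coefZ, coefXn, coefX, coefC) /= mulr0 !addr0 => /eqP.
by rewrite oner_eq0.
Qed.

HB.instance Definition _ (R : realType) := GRing.RMorphism.copy (@ratc R)
  (@tofrac _ \o (polyC \o real_complex R)).

Definition fracC (R : realType) : R[i] -> ratfun R[i] := @tofrac _ \o polyC.
HB.instance Definition _ (R : realType) := GRing.RMorphism.copy (@fracC R)
  (@tofrac _ \o polyC).

(** Diagonalizing the Laplacian by constants diagonalizes the quadratic pencil
    over the rational functions, where every modal denominator, being monic,
    is invertible, the null mode included. *)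
Lemma transfer_function_modal (R : realType) n m (e : rel 'I_n)
    (hd tl : 'I_m -> 'I_n) (kp ku : R) Delta (P : 'M[R[i]]_n) (d : 'I_n -> R) :
  P \is unitarymx ->
  map_mx (real_complex R) (laplacian R e) =
    P^t* *m diag_mx (\row_i (d i)%:C) *m P ->
  transfer_function (formation_system e hd tl kp ku Delta) =
  map_mx (@fracC R) ((P *m map_mx (real_complex R) (incidence R hd tl))^t*)
  *m diag_mx (\row_i (tofrac (modal_den kp ku (d i)))^-1)
  *m map_mx (@fracC R) P.
Proof.
move=> uP LE; rewrite /transfer_function /=.
have toC p q (M : 'M[R]_(p, q)) :
    map_mx (@ratc R) M = map_mx (@fracC R) (map_mx (real_complex R) M).
  by rewrite -map_mx_comp.
rewrite map_row_mx map_block_mx map_col_mx !map_mxN !map_mxZ !map_mx0 !map_mx1.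
rewrite -mulmxA.
pose Q' := map_mx (@fracC R) (P^t*); pose P' := map_mx (@fracC R) P.
pose den i := modal_den kp ku (d i).
pose Y := Q' *m diag_mx (\row_i (tofrac (den i))^-1) *m P'.
rewrite (@second_order_resolvent _ _ _ Y); last first.
  rewrite toC LE !map_mxM map_diag_mx -/Q' -/P'.
  set x := map_mx _ _.
  have denE i : tofrac (den i) =
      tofrac 'X ^+ 2 + tofrac 'X * ratc ku * x 0 i + ratc kp * x 0 i.
    rewrite /den /modal_den !mxE /ratc /fracC /=.
    by rewrite !tofracD tofracXn -mul_polyC !rmorphM /= [tofrac 'X * _]mulrC
      mulrAC.
  have -> : Y = Q' *m diag_mx (\row_i
    (tofrac 'X ^+ 2 + tofrac 'X * ratc ku * x 0 i + ratc kp * x 0 i)^-1) *m P'.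
    rewrite /Y; congr (_ *m diag_mx _ *m _); apply/rowP => i.
    by rewrite mxE denE [in RHS]mxE.
  apply: diag_resolvent => [|i].
    by rewrite /P' /Q' -map_mxM (unitarymxP uP) map_mx1.
  by rewrite -denE tofrac_eq0 modal_den_neq0.
rewrite mul_row_col mul0mx addr0 toC /Y !mulmxA; congr (_ *m _ *m _).
by rewrite -map_mxM -real_complex_trC -map_mxM -trmx_mul.
Qed.

(** * Gain on the imaginary axis *)

Lemma sqr_normc_modal_den (R : realType) (kp ku x w : R) :
  `|(modal_den kp ku x).[0 +i* w]| ^+ 2 =
  ((kp * x - w ^+ 2) ^+ 2 + (ku * x * w) ^+ 2)%:C.
Proof.
rewrite -add_Re2_Im2 !hornerE /= !mul0r !mulr0 !(add0r, addr0, sub0r).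
rewrite oppr0 ?(add0r, addr0); congr (_%:C); ring.
Qed.

(** With positive stiffness and damping, a nonzero mode has no pole on the
    imaginary axis: the imaginary part vanishes only at frequency 0, where the
    real part does not. *)
Lemma modal_den_axis_neq0 (R : realType) (kp ku x w : R) :
  0 < kp -> 0 < ku -> x != 0 -> (modal_den kp ku x).[0 +i* w] != 0.
Proof.
move=> kp0 ku0 x0; rewrite -normr_eq0 -sqrf_eq0 sqr_normc_modal_den.
rewrite (inj_eq (@complexI R)) paddr_eq0 ?sqr_ge0 // !sqrf_eq0.
rewrite !mulf_eq0 (gt_eqF ku0) (negPf x0) /=.
apply/andP => -[+ /eqP w0]; rewrite w0 expr0n subr0 mulf_eq0 (gt_eqF kp0).
by rewrite (negPf x0).
Qed.

(** Here M^* M = P^* diag(d |phi|^2) P, because W W^* = diag(d): the squared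
    singular values are read off the modes. *)
Lemma sigma_max_modal (R : realType) n m (W : 'M[R[i]]_(n, m)) (P : 'M[R[i]]_n)
    (d : 'I_n -> R) (phi : 'I_n -> R[i]) (g : 'I_n -> R) :
  P \is unitarymx -> W *m W^t* = diag_mx (\row_i (d i)%:C) ->
  (forall i, (d i)%:C * `|phi i| ^+ 2 = (g i)%:C) ->
  sigma_max (W^t* *m diag_mx (\row_i phi i) *m P) =
  Num.sqrt (last 0 (sort <=%R [seq g i | i <- enum 'I_n])).
Proof.
move=> uP WW dg; rewrite /sigma_max; congr (Num.sqrt (last 0 _)).
rewrite -(herm_eigvals_unitary_diag g uP); congr herm_eigvals.
rewrite !trmx_mul !map_mxM trmxCK !mulmxA -(mulmxA _ W) WW.
congr (_ *m _); rewrite -!mulmxA; congr (_ *m _).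
rewrite tr_diag_mx map_diag_mx !mulmx_diag; congr diag_mx.
by apply/rowP => i; rewrite !mxE -dg normCK; ring.
Qed.

(** The squared modulus of sqrt x / (s^2 + ku x s + kp x) at s = i w. *)
Definition mode_gain_sq (R : realType) (kp ku x w : R) : R :=
  x / ((kp * x - w ^+ 2) ^+ 2 + (ku * x * w) ^+ 2).

(** The only possible pole on the imaginary axis comes from the null modes, and
    the corresponding rows of W vanish. *)
Lemma gain_modal (R : realType) n m (W : 'M[R[i]]_(n, m)) (P : 'M[R[i]]_n)
    (d : 'I_n -> R) (kp ku w : R) :
  0 < kp -> 0 < ku ->
  P \is unitarymx -> W *m W^t* = diag_mx (\row_i (d i)%:C) ->
  gain (map_mx (@fracC R) (W^t*)
    *m diag_mx (\row_i (tofrac (modal_den kp ku (d i)))^-1)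
    *m map_mx (@fracC R) P) (0 +i* w) =
  (Num.sqrt (last 0
    (sort <=%R [seq mode_gain_sq kp ku (d i) w | i <- enum 'I_n])))%:E.
Proof.
move=> kp0 ku0 uP WW; set G := _ *m _; set z := 0 +i* w.
(* The value 0 at a null mode is a convenience: that mode is multiplied by a
   null row of W, which is how the pole at the origin cancels. *)
pose phi i := if d i == 0 then 0 else (modal_den kp ku (d i)).[z]^-1.
have GE k l :
    regular_value z (G k l) ((W^t* *m diag_mx (\row_i phi i) *m P) k l).
  rewrite /G !mul_mx_diag.
  rewrite [X in regular_value _ X _]mxE [X in regular_value _ _ X]mxE.
  apply: regular_sum => i; rewrite ![(\matrix_(_, _) _) _ _]mxE.
  have [di0|di0] := eqVneq (d i) 0.
    have W0 : (W^t*) k i = 0.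
      by rewrite !mxE (gram_diag i WW).2 // rmorph0.
    rewrite mxE W0 rmorph0 !mul0r -(horner0 z) -tofrac0; exact: regular_poly.
  have constE c : regular_value z (fracC c) c.
    by have := regular_poly z c%:P; rewrite hornerC.
  rewrite [map_mx _ (W^t*) _ _]mxE [map_mx _ P _ _]mxE.
  rewrite /phi (negPf di0); apply: regular_mul; last exact: constE.
  apply: regular_mul; first exact: constE.
  by apply: regular_polyV; apply: modal_den_axis_neq0.
rewrite /gain ifF; last first.
  apply/negbTE; rewrite negb_exists; apply/fintype.forallP => k.
  rewrite negb_exists; apply/fintype.forallP => l.
  exact: (regular_valueP (GE k l)).1.
have -> : map_mx (fun f => reval f z) G = W^t* *m diag_mx (\row_i phi i) *m P.
  by apply/matrixP => k l; rewrite mxE (regular_valueP (GE k l)).2.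
congr EFin; apply: (sigma_max_modal uP WW) => i; rewrite /phi /mode_gain_sq.
have [->|di0] := eqVneq (d i) 0; first by rewrite normr0 expr0n mulr0 mul0r.
by rewrite normrV ?unitfE ?modal_den_axis_neq0 // exprVn sqr_normc_modal_den
  rmorphM fmorphV.
Qed.

(** * Peak of the modal gains *)

Definition peak_gain (R : realType) (kp ku l : R) : R :=
  if l * ku ^+ 2 / (2 * kp) <= 1
  then 2 / (ku * l * Num.sqrt (4 * kp - ku ^+ 2 * l))
  else 1 / (kp * Num.sqrt l).

(** Write y for w^2. If ku^2 x <= 2 kp the denominator, a quadratic in y, is
    least at a nonnegative y, and its least value divided by x is
    ku^2 x^2 (4 kp - ku^2 x) / 4, which increases with x in that range. If
    ku^2 x > 2 kp it is least at y = 0, with quotient kp^2 x. The two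
    expressions agree when ku^2 x = 2 kp, and the second one dominates the
    first everywhere, so that the bound at x follows from the bound at l <= x
    in all cases. *)
Lemma mode_gain_le (R : realType) (kp ku l x w : R) :
  0 < kp -> 0 < ku -> 0 < l -> l <= x ->
  mode_gain_sq kp ku x w <= peak_gain kp ku l ^+ 2.
Proof.
rewrite /mode_gain_sq /peak_gain => kp0 ku0 l0 lx.
have x0 : 0 < x by exact: lt_le_trans lx.
have y0 := sqr_ge0 w; rewrite (exprMn _ (ku * x)); move: (w ^+ 2) y0 => y y0.
have kx : 0 < ku * x by rewrite mulr_gt0.
have den0 : 0 < (kp * x - y) ^+ 2 + (ku * x) ^+ 2 * y.
  have [->|yN0] := eqVneq y 0.
    by rewrite subr0 mulr0 addr0 exprn_gt0 ?mulr_gt0.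
  by rewrite ltr_wpDl ?sqr_ge0 // mulr_gt0 ?exprn_gt0 // lt0r yN0.
(* Completing the square in y exhibits the resonant minimum. *)
have sq : (kp * x - y) ^+ 2 + (ku * x) ^+ 2 * y =
    (y - (kp * x - ku ^+ 2 * x ^+ 2 / 2)) ^+ 2
    + ku ^+ 2 * x ^+ 3 * (4 * kp - ku ^+ 2 * x) / 4 by field.
have key a : 0 < a -> a * x <= (kp * x - y) ^+ 2 + (ku * x) ^+ 2 * y ->
   x / ((kp * x - y) ^+ 2 + (ku * x) ^+ 2 * y) <= a^-1.
  by move=> a0 h; rewrite ler_pdivrMr // mulrC ler_pdivlMr // mulrC.
(* Without resonance the denominator is least at frequency zero. *)
have stiff : 2 * kp < ku ^+ 2 * x ->
    kp ^+ 2 * x * x <= (kp * x - y) ^+ 2 + (ku * x) ^+ 2 * y.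
  move=> kx2; rewrite -subr_ge0.
  have -> : (kp * x - y) ^+ 2 + (ku * x) ^+ 2 * y - kp ^+ 2 * x * x =
    y * (y + x * (ku ^+ 2 * x - 2 * kp)) by ring.
  by rewrite mulr_ge0 // addr_ge0 // mulr_ge0 ?subr_ge0 // ltW.
have -> : (l * ku ^+ 2 / (2 * kp) <= 1) = (ku ^+ 2 * l <= 2 * kp).
  by rewrite ler_pdivrMr ?mulr_gt0 // mul1r mulrC.
case: ifP => hl.
  have h4 : 0 < 4 * kp - ku ^+ 2 * l by lra.
  have -> : (2 / (ku * l * Num.sqrt (4 * kp - ku ^+ 2 * l))) ^+ 2 =
     (ku ^+ 2 * l ^+ 2 * (4 * kp - ku ^+ 2 * l) / 4)^-1.
    rewrite -[in RHS](sqr_sqrtr (ltW h4)).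
    by field; rewrite !gt_eqF ?sqrtr_gt0.
  apply: key; first by rewrite !(mulr_gt0, exprn_gt0, invr_gt0).
  have [kx2|kx2] := leP (ku ^+ 2 * x) (2 * kp).
    rewrite sq -[leLHS]add0r lerD ?sqr_ge0 //.
    have -> : ku ^+ 2 * l ^+ 2 * (4 * kp - ku ^+ 2 * l) / 4 * x =
      ku ^+ 2 * x / 4 * (l ^+ 2 * (4 * kp - ku ^+ 2 * l)) by ring.
    have -> : ku ^+ 2 * x ^+ 3 * (4 * kp - ku ^+ 2 * x) / 4 =
      ku ^+ 2 * x / 4 * (x ^+ 2 * (4 * kp - ku ^+ 2 * x)) by ring.
    rewrite ler_pM2l; last by rewrite !(mulr_gt0, exprn_gt0, invr_gt0).
    rewrite -subr_ge0.
    (* Both ku^2 x and ku^2 l are at most 2 kp here, so every term of the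
       second factor is nonnegative. *)
    have -> : x ^+ 2 * (4 * kp - ku ^+ 2 * x)
        - l ^+ 2 * (4 * kp - ku ^+ 2 * l) =
      (x - l) * (x * (2 * kp - ku ^+ 2 * x) + l * (2 * kp - ku ^+ 2 * x) +
         l * (2 * kp - ku ^+ 2 * l) + 2 * kp * x) by ring.
    by rewrite mulr_ge0 ?subr_ge0 // !addr_ge0 ?mulr_ge0 ?subr_ge0 // ?ltW.
  rewrite (le_trans _ (stiff kx2)) // ler_pM2r //.
  (* The resonant peak of l is compared with the static gain 1 / (kp^2 l). *)
  have : kp ^+ 2 * l <= kp ^+ 2 * x by rewrite ler_pM2l ?exprn_gt0.
  apply: le_trans.
  have -> : ku ^+ 2 * l ^+ 2 * (4 * kp - ku ^+ 2 * l) / 4 =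
     kp ^+ 2 * l - l * (2 * kp - ku ^+ 2 * l) ^+ 2 / 4 by field.
  by rewrite gerBl divr_ge0 // mulr_ge0 ?sqr_ge0 // ltW.
have -> : (1 / (kp * Num.sqrt l)) ^+ 2 = (kp ^+ 2 * l)^-1.
  by rewrite mul1r exprVn exprMn sqr_sqrtr // ltW.
apply: key; first by rewrite mulr_gt0 ?exprn_gt0.
have kx2 : 2 * kp < ku ^+ 2 * x.
  move/negbT: hl; rewrite -ltNge => /lt_le_trans; apply.
  by rewrite ler_pM2l ?exprn_gt0.
rewrite (le_trans _ (stiff kx2)) // ler_pM2r //.
by rewrite ler_pM2l ?exprn_gt0.
Qed.

Lemma mode_gain_attained (R : realType) (kp ku l : R) :
  0 < kp -> 0 < ku -> 0 < l ->
  exists w, mode_gain_sq kp ku l w = peak_gain kp ku l ^+ 2.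
Proof.
rewrite /mode_gain_sq /peak_gain => kp0 ku0 l0.
have -> : (l * ku ^+ 2 / (2 * kp) <= 1) = (ku ^+ 2 * l <= 2 * kp).
  by rewrite ler_pdivrMr ?mulr_gt0 // mul1r mulrC.
case: ifP => hl.
  have h4 : 0 < 4 * kp - ku ^+ 2 * l by lra.
  (* The frequency at which the completed square vanishes. *)
  exists (Num.sqrt (l * (kp - ku ^+ 2 * l / 2))).
  rewrite exprMn sqr_sqrtr; last by apply: mulr_ge0; [exact: ltW | lra].
  rewrite [(2 / _) ^+ 2]exprMn exprVn [(ku * l * Num.sqrt _) ^+ 2]exprMn.
  rewrite sqr_sqrtr ?(ltW h4) //.
  have -> : (kp * l - l * (kp - ku ^+ 2 * l / 2)) ^+ 2 +
    (ku * l) ^+ 2 * (l * (kp - ku ^+ 2 * l / 2)) =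
    ku ^+ 2 * l ^+ 3 * (4 * kp - ku ^+ 2 * l) / 4 by field.
  by field; rewrite !gt_eqF.
exists 0.
rewrite mul1r exprVn [(kp * Num.sqrt l) ^+ 2]exprMn sqr_sqrtr ?(ltW l0) //.
by field; rewrite !gt_eqF.
Qed.

(** * The norm of the formation system *)

Theorem theorem5 (R : realType) (n m : nat) (hn : (2 <= n)%N)
    (e : rel 'I_n) (he_sym : symmetric e) (he_irr : irreflexive e)
    (he_conn : graph_connected e)
    (hd tl : 'I_m -> 'I_n) (h_or : oriented_edges e hd tl)
    (kp ku : R) (hkp : 0 < kp) (hku : 0 < ku)
    (Delta : 'I_n -> 'I_n -> R)
    (hDelta : forall i j k : 'I_n, Delta i j = Delta i k + Delta k j) :
  let lambda2 := algebraic_connectivity R e in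
  hinf_norm (transfer_function (formation_system e hd tl kp ku Delta)) =
    (if lambda2 * ku ^+ 2 / (2 * kp) <= 1
     then 2 / (ku * lambda2 * Num.sqrt (4 * kp - ku ^+ 2 * lambda2))
     else 1 / (kp * Num.sqrt lambda2))%:E.
Proof.
move=> lambda2.
have [P [d [uP LE WW]]] := gram_spectral (incidence R hd tl).
rewrite -(laplacian_incidence R he_irr h_or) in LE.
have l2E : lambda2 = (sort <=%R [seq d i | i <- enum 'I_n])`_1.
  by rewrite /lambda2 /algebraic_connectivity LE herm_eigvals_unitary_diag.
have := laplacian_spectrum hn he_irr he_conn h_or uP WW.
rewrite -l2E /= => -[l0 [i0 di0] dl].
rewrite (transfer_function_modal _ _ _ _ _ uP LE) /hinf_norm; set G := _ *m _.
have gainE w := gain_modal w hkp hku uP WW.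
rewrite -/(peak_gain kp ku lambda2); set V := peak_gain _ _ _.
have V0 : 0 <= V.
  rewrite /V /peak_gain.
  by case: ifP => _; rewrite divr_ge0 ?mulr_ge0 ?sqrtr_ge0 // ltW.
pose gains w := sort <=%R [seq mode_gain_sq kp ku (d i) w | i <- enum 'I_n].
have gains_le w x : x \in gains w -> x <= V ^+ 2.
  rewrite mem_sort => /mapP [i _ ->]; have [->|ld] := dl i.
    by rewrite /mode_gain_sq mul0r sqr_ge0.
  exact: mode_gain_le.
have mem_l w : mode_gain_sq kp ku (d i0) w \in
    [seq mode_gain_sq kp ku (d i) w | i <- enum 'I_n].
  by apply/mapP; exists i0; rewrite ?mem_enum.
have last_le w : last 0 (gains w) <= V ^+ 2.
  by apply: (gains_le w); rewrite mem_sort; exact: (last_sort_max (mem_l w)).1.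
apply/eqP; rewrite eq_le; apply/andP; split.
  apply: ge_ereal_sup => _ [w _ <-]; rewrite gainE lee_fin.
  by rewrite -(ger0_norm V0) -sqrtr_sqr ler_wsqrtr ?last_le.
have [w wE] := mode_gain_attained hkp hku l0.
apply: ereal_sup_ubound; exists w => //; rewrite gainE; congr EFin.
rewrite -(ger0_norm V0) -sqrtr_sqr; congr Num.sqrt.
apply/eqP; rewrite eq_le last_le -wE -di0.
exact: (last_sort_max (mem_l w)).2.
Qed.
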